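(* For every integer $n\ge 0$, $$\mathrm{RS}_n(122)=\mathrm{LB}_n(123)=\mathrm{RS}_n(123)=1+\sum_{k=0}^{n-2}\binom{n-1}{k+1}q^k.$$
   Context: A restricted growth function (RGF) of length $n$ is a sequence $w=w_1\dots w_n$ of positive integers with $w_1=1$ and $w_i\le 1+\max\{w_1,\dots,w_{i-1}\}$ for $i\ge 2$ ($R_0$ consists of the empty word); $R_n$ is the set of RGFs of length $n$. The standardization of a word replaces every occurrence of its smallest letter by $1$, of its next smallest letter by $2$, and so on. An RGF $w$ contains an RGF $v$ if some subword (subsequence, not necessarily consecutive) of $w$ standardizes to $v$; otherwise $w$ avoids $v$. $R_n(v)$ is the set of $w\in R_n$ avoiding $v$. For a word $w$ and position $j$: $\mathrm{lb}(w_j)$ is the number of distinct values $w_i$ with $i<j$ and $w_i>w_j$; $\mathrm{rs}(w_j)$ is the number of distinct values $w_i$ with $i>j$ and $w_i<w_j$; $\mathrm{lb}(w)=\sum_j\mathrm{lb}(w_j)$, $\mathrm{rs}(w)=\sum_j\mathrm{rs}(w_j)$. Then $\mathrm{LB}_n(v)=\sum_{w\in R_n(v)}q^{\mathrm{lb}(w)}$ and $\mathrm{RS}_n(v)=\sum_{w\in R_n(v)}q^{\mathrm{rs}(w)}$. *)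

(* Defs.v *)
From mathcomp Require Import all_boot all_order all_algebra.

Set Implicit Arguments.
Unset Strict Implicit.
Unset Printing Implicit Defensive.

Import GRing.Theory.

(* Words are sequences of natural numbers; positions are counted from 0, so
   the letter w_{i+1} of the mathematical text is [nth 0 w i]. *)

Definition is_rgf (w : seq nat) : bool :=
  all (leq 1) w &&
  [forall i : 'I_(size w),
     if i == 0 :> nat then nth 0 w i == 1
     else nth 0 w i <= 1 + \max_(x <- take i w) x].

Definition standardize (w : seq nat) : seq nat :=
  [seq (index x (sort leq (undup w))).+1 | x <- w].

(* The subwords of [w] are exactly the [mask m w], [m] a bit vector. *)
Definition contains (w v : seq nat) : bool :=
  [exists m : (size w).-tuple bool, standardize (mask m w) == v].

Definition avoids (w v : seq nat) : bool := ~~ contains w v.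

(* The letters of an RGF of length n are at most n, so restricting the
   enumeration to letters in {0, ..., n} loses nothing: see [mem_RGF]. *)
Definition RGF (n : nat) : seq (seq nat) :=
  [seq w <- [seq map val t | t : n.-tuple 'I_n.+1] | is_rgf w].

Definition RGF_avoiding (n : nat) (v : seq nat) : seq (seq nat) :=
  [seq w <- RGF n | avoids w v].

Definition lb_at (w : seq nat) (j : nat) : nat :=
  size (undup [seq x <- take j w | nth 0 w j < x]).

Definition rs_at (w : seq nat) (j : nat) : nat :=
  size (undup [seq x <- drop j.+1 w | x < nth 0 w j]).

Definition lb (w : seq nat) : nat := \sum_(j < size w) lb_at w j.

Definition rs (w : seq nat) : nat := \sum_(j < size w) rs_at w j.

Definition LB (n : nat) (v : seq nat) : {poly int} :=
  (\sum_(w <- RGF_avoiding n v) 'X^(lb w))%R.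

Definition RS (n : nat) (v : seq nat) : {poly int} :=
  (\sum_(w <- RGF_avoiding n v) 'X^(rs w))%R.

Lemma RGF_uniq n : uniq (RGF n).
Proof.
apply: filter_uniq; rewrite map_inj_uniq ?enum_uniq // => s t /(inj_map val_inj).
exact: val_inj.
Qed.

Lemma rgf_nth_le w i : is_rgf w -> i < size w -> nth 0 w i <= i.+1.
Proof.
case/andP=> _ /forallP rgf_w; elim/ltn_ind: i => i IHi lt_i_w.
have := rgf_w (Ordinal lt_i_w) => /=.
case: eqP => [-> /eqP-> // | _ le_wi]; apply: leq_trans le_wi _.
rewrite add1n ltnS; apply/bigmax_leqP_seq => x /(nthP 0)[j].
rewrite size_take lt_i_w => lt_j_i <- _; rewrite nth_take //.
exact: leq_trans (IHi j lt_j_i (ltn_trans lt_j_i lt_i_w)) lt_j_i.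
Qed.

Lemma mem_RGF n w : (w \in RGF n) = is_rgf w && (size w == n).
Proof.
rewrite mem_filter; apply: andb_id2l => rgf_w; apply/imageP/eqP.
  by case=> t _ ->; rewrite size_map size_tuple.
move=> sz_w; have sz_m : size (map (@inord n) w) == n by rewrite size_map sz_w.
exists (Tuple sz_m) => //=; rewrite -map_comp -[LHS]map_id.
apply/eq_in_map => x /(nthP 0)[i lt_i <-] /=; rewrite inordK // ltnS.
by apply: leq_trans (rgf_nth_le rgf_w lt_i) _; rewrite -sz_w.
Qed.

(* Main.v *)
Require Import Defs.
From mathcomp Require Import all_boot all_order all_algebra.
From mathcomp Require Import zify ring.

(** An RGF of length m+1 avoiding 123 is 1 followed by an arbitrary word in
   {1, 2}; one avoiding 122 is 1 followed by a word whose letters other than 1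
   are 2, 3, 4, ... in this order.  Both are thus encoded by the m bits telling
   which letters exceed 1, and on both [rs] counts the true bits that have a
   false bit to their right.  On 123-avoiders [lb] counts the false bits that
   have a true bit to their left, which is the same statistic after reversing
   and negating the bits.  Splitting off the first bit gives a recurrence that
   the right-hand side satisfies by Pascal's rule. *)

Set Implicit Arguments.
Unset Strict Implicit.
Unset Printing Implicit Defensive.

Import GRing.Theory.

(** * Bit sequences and their statistic *)

Fixpoint bitseqs (m : nat) : seq bitseq :=
  if m is m'.+1
  then map (cons false) (bitseqs m') ++ map (cons true) (bitseqs m')
  else [:: [::]].

Lemma mem_bitseqs m b : (b \in bitseqs m) = (size b == m).
Proof.
have cons_inj c : injective (@cons bool c) by move=> s t [].
elim: m b => [|m IHm] [|c b] //=; rewrite mem_cat.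
  by apply/orP; case=> /mapP[].
have notin c' : c != c' -> (c :: b \in map (cons c') (bitseqs m)) = false.
  by move=> ne; apply/mapP => -[? _ [/eqP]]; rewrite (negPf ne).
rewrite eqSS -IHm; case: c notin => notin.
  by rewrite (notin false) // mem_map.
by rewrite (notin true) // orbF mem_map.
Qed.

Lemma bitseqs_uniq m : uniq (bitseqs m).
Proof.
have cons_inj c : injective (@cons bool c) by move=> s t [].
elim: m => //= m IHm; rewrite cat_uniq !map_inj_uniq // IHm andbT /=.
by apply/hasPn => _ /mapP[b _ ->]; apply/mapP => -[].
Qed.

Fixpoint true_before_false (b : bitseq) : nat :=
  if b is c :: b' then (c && has negb b') + true_before_false b' else 0.

Section GeneratingFunction.

Local Open Scope ring_scope.

(** Only the all-true sequence contributes. This turns a correction constant into a sum over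
    [bitseqs m], so that the recurrence below can be checked termwise. *)
Lemma sum_bitseqs_all_true (R : nmodType) (c : R) m :
  \sum_(b <- bitseqs m) (if has negb b then 0 else c) = c.
Proof.
elim: m => [|m IHm] /=; first by rewrite big_seq1.
by rewrite big_cat !big_map /= IHm big1 ?add0r.
Qed.

(* A leading true bit adds 1 to the statistic unless all other bits are true;
   this exceptional word accounts for the term [1 - 'X]. *)
Lemma sum_bitseqsS m :
  \sum_(b <- bitseqs m.+1) 'X^(true_before_false b) =
  (1 + 'X) * (\sum_(b <- bitseqs m) 'X^(true_before_false b)) + 1 - 'X
  :> {poly int}.
Proof.
rewrite big_cat !big_map /= mulrDl mul1r -!addrA; congr (_ + _).
rewrite -[1 - 'X](sum_bitseqs_all_true _ m) mulr_sumr -big_split /=.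
apply: eq_bigr => b _; case: ifP => [_|all_b].
  by rewrite add1n exprS addr0.
suff -> : true_before_false b = 0%N by rewrite expr0; ring.
by elim: b all_b => //= c b IHb /norP[_ /negPf nf]; rewrite nf andbF IHb.
Qed.

(** After Pascal's rule, the top term of the ['C(m, k.+1)] sum vanishes, while the ['C(m, k)] sum
    splits into its constant term 1 and a shifted copy carrying the factor ['X]. *)
Lemma sum_binS m :
  \sum_(0 <= k < m.+1) 'C(m.+1, k.+1)%:R *: 'X^k =
  (1 + 'X) * (\sum_(0 <= k < m) 'C(m, k.+1)%:R *: 'X^k) + 1 :> {poly int}.
Proof.
under eq_bigr do rewrite binS natrD scalerDl.
rewrite big_split /= big_nat_recr //= bin_small // scale0r addr0.
rewrite big_nat_recl //= bin0 scale1r expr0 mulrDl mul1r -addrA.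
congr (_ + _); rewrite addrC mulr_sumr; congr (_ + _).
by apply: eq_bigr => k _; rewrite exprS scalerAr.
Qed.

Lemma sum_bitseqsE m :
  \sum_(b <- bitseqs m) 'X^(true_before_false b) =
  1 + \sum_(0 <= k < m) 'C(m, k.+1)%:R *: 'X^k :> {poly int}.
Proof.
elim: m => [|m IHm]; first by rewrite big_seq1 big_geq ?addr0.
by rewrite sum_bitseqsS IHm sum_binS; ring.
Qed.

Lemma sum_bitseqs_rev_negb m (F : bitseq -> {poly int}) :
  \sum_(b <- bitseqs m) F (rev (map negb b)) = \sum_(b <- bitseqs m) F b.
Proof.
have negbKmap : involutive (map negb) := mapK negbK.
pose phi b := rev (map negb b).
have phiK : involutive phi by move=> b; rewrite /phi map_rev revK negbKmap.
rewrite -(big_map phi xpredT F); apply: perm_big.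
apply: uniq_perm; rewrite ?map_inj_uniq ?bitseqs_uniq //.
  exact: inv_inj.
move=> b; rewrite -[b in LHS]phiK mem_map; last exact: inv_inj.
by rewrite !mem_bitseqs size_rev size_map.
Qed.

End GeneratingFunction.

(** * Recursive RGF test and pattern containment *)

(* [k] is the largest letter preceding [w] in the full word, 0 if there is
   none. *)
Fixpoint rgf_from (k : nat) (w : seq nat) : bool :=
  if w is x :: w' then (0 < x <= k.+1) && rgf_from (maxn k x) w' else true.

Lemma is_rgf_from w : is_rgf w = rgf_from 0 w.
Proof.
have E k s : rgf_from k s = all (leq 1) s &&
    [forall i : 'I_(size s),
      nth 0 s i <= 1 + maxn k (\max_(x <- take i s) x)].
  elim: s k => [|x s IHs] k /=; first by apply/esym/forallP => -[].
  rewrite {}IHs -!andbA; congr (_ && _); rewrite andbCA; congr (_ && _).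
  apply/andP/forallP => [[lex /forallP H] [[|i] /= lti]|H].
  - by rewrite big_nil maxn0.
  - by rewrite big_cons maxnA; apply: (H (Ordinal (lti : i < size s))).
  split; first by have := H ord0; rewrite /= big_nil maxn0.
  apply/forallP => i; have := H (lift ord0 i).
  by rewrite /= big_cons maxnA.
rewrite E /is_rgf; case all_w: (all _ w) => //=.
apply: eq_forallb => -[[|i] lti] //=; last by rewrite max0n.
(* The tests differ only at the first letter: equal to 1 against at most 1. Positivity reconciles
   them. *)
rewrite take0 big_nil maxnn; have := all_nthP 0 all_w 0 lti.
by case: (nth 0 w 0) => [|[]].
Qed.

Lemma rgf_from_pos k w : rgf_from k w -> all (leq 1) w.
Proof. by elim: w k => //= x w IHw k /andP[/andP[-> _] /IHw]. Qed.

Lemma containsP w v :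
  reflect (exists2 s, subseq s w & standardize s = v) (contains w v).
Proof.
apply: (iffP existsP) => [[m /eqP def_v]|[s /subseqP[m sz_m ->] def_v]].
  by exists (mask m w); rewrite ?mask_subseq.
by exists (Tuple (introT eqP sz_m)); apply/eqP.
Qed.

(** A standardized letter is its rank among the distinct letters. Hence a pattern can be recognized
    from the relative order of the letters alone. *)
Lemma nth_standardize_lt s i j : i < size s -> j < size s ->
  (nth 0 (standardize s) i < nth 0 (standardize s) j) = (nth 0 s i < nth 0 s j).
Proof.
move=> lti ltj; rewrite !(nth_map 0) // ltnS.
have mem_s k : k < size s -> nth 0 s k \in sort leq (undup s).
  by move=> ltk; rewrite mem_sort mem_undup mem_nth.
have sorted_s : sorted leq (sort leq (undup s)) by exact: (sort_sorted leq_total).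
apply/idP/idP; last first.
  apply: contraLR; rewrite -!leqNgt.
  by apply: (sorted_leq_index leq_trans leqnn sorted_s); exact: mem_s.
apply: (sorted_ltn_index ltn_trans); try exact: mem_s.
by rewrite ltn_sorted_uniq_leq sort_uniq undup_uniq.
Qed.

Lemma standardize123 s :
  standardize s = [:: 1; 2; 3] <-> exists a b c, s = [:: a; b; c] /\ a < b < c.
Proof.
split=> [def_s|[a [b [c [-> /andP[lt_ab lt_bc]]]]]].
  have sz_s : size s = 3 by have /(congr1 size) := def_s; rewrite size_map.
  have lt_s i j (lti : i < 3) (ltj : j < 3) :
      (nth 0 s i < nth 0 s j) = (nth 0 [:: 1; 2; 3] i < nth 0 [:: 1; 2; 3] j).
    by rewrite -def_s nth_standardize_lt ?sz_s.
  case: s sz_s lt_s {def_s} => [|a [|b [|c []]]] // _ lt_s.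
  exists a, b, c; split=> //.
  by rewrite (lt_s 0 1) // (lt_s 1 2).
have lt_ac := ltn_trans lt_ab lt_bc.
have uniq_s : uniq [:: a; b; c] by rewrite /= !inE; lia.
have sorted_s : sorted leq [:: a; b; c] by rewrite /= (ltnW lt_ab) (ltnW lt_bc).
rewrite /standardize (undup_id uniq_s) (sorted_sort leq_trans sorted_s) /=.
by rewrite !eqxx (ltn_eqF lt_ab) (ltn_eqF lt_ac) (ltn_eqF lt_bc).
Qed.

Lemma standardize122 s :
  standardize s = [:: 1; 2; 2] <-> exists a b, s = [:: a; b; b] /\ a < b.
Proof.
split=> [def_s|[a [b [-> lt_ab]]]].
  have sz_s : size s = 3 by have /(congr1 size) := def_s; rewrite size_map.
  have lt_s i j (lti : i < 3) (ltj : j < 3) :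
      (nth 0 s i < nth 0 s j) = (nth 0 [:: 1; 2; 2] i < nth 0 [:: 1; 2; 2] j).
    by rewrite -def_s nth_standardize_lt ?sz_s.
  case: s sz_s lt_s {def_s} => [|a [|b [|c []]]] // _ lt_s.
  have lt_ab := lt_s 0 1 isT isT; have nlt_bc := lt_s 1 2 isT isT.
  have nlt_cb := lt_s 2 1 isT isT; rewrite /= in lt_ab nlt_bc nlt_cb.
  have <- : b = c by lia.
  by exists a, b.
have undup_s : undup [:: a; b; b] = [:: a; b].
  by rewrite /= !inE eqxx orbb (ltn_eqF lt_ab).
have sorted_s : sorted leq [:: a; b] by rewrite /= ltnW.
rewrite /standardize undup_s (sorted_sort leq_trans sorted_s) /=.
by rewrite !eqxx (ltn_eqF lt_ab).
Qed.

(** * Avoiders encoded by bits *)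

Definition two_letters (b : bitseq) : seq nat := [seq (nat_of_bool c).+1 | c <- b].

(** [k] is the next new letter: without repetition, each letter above 1 must be a new maximum. *)
Fixpoint ascending_letters (k : nat) (b : bitseq) : seq nat :=
  if b is c :: b' then
    if c then k :: ascending_letters k.+1 b' else 1 :: ascending_letters k b'
  else [::].

Lemma two_lettersK : cancel two_letters (map (leq 2)).
Proof. by elim=> //= -[] b ->. Qed.

Lemma ascending_lettersK k :
  1 < k -> cancel (ascending_letters k) (map (leq 2)).
Proof.
by move=> k_gt1 b; elim: b k k_gt1 => [|[] b IHb] k k_gt1 //=;
  rewrite IHb ?k_gt1 // ltnW.
Qed.

Lemma rgf_from_two_letters k w : 0 < k ->
  rgf_from k w && all (geq 2) w = (w == two_letters (map (leq 2) w)).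
Proof.
elim: w k => //= x w IHw k k_gt0; rewrite eqseq_cons -(IHw (maxn k x)).
  by case: rgf_from => /=; case: all; rewrite ?andbF ?andbT //=; case: leqP; lia.
by rewrite leq_max k_gt0.
Qed.

(** The lower bound on the filtered letters strengthens the induction: against the RGF bound [k.+1],
    it forces the first letter above 1 to be exactly [k.+1]. For [k = 1] it holds by the filter
    itself. *)
Lemma rgf_from_ascending k w : 0 < k ->
  [&& rgf_from k w, uniq (filter (leq 2) w) & all (leq k.+1) (filter (leq 2) w)]
  = (w == ascending_letters k.+1 (map (leq 2) w)).
Proof.
elim: w k => //= x w IHw k k_gt0.
case: (leqP 2 x) => [x_ge2|x_le1] /=; rewrite eqseq_cons; last first.
  rewrite -IHw //; case: x x_le1 => [|[|]] //= _.
  by have /maxn_idPl-> : 0 < k by [].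
have [eq_x|ne_x] := eqVneq x k.+1; last first.
  by apply/negP => /and3P[/andP[/andP[_ lex] _] _ /andP[gex _]]; case/eqP: ne_x; lia.
rewrite -IHw // {}eq_x leqnn (maxn_idPr (leqnSn k)) /=.
(* Uniqueness excludes [k.+1] from the rest, which raises the lower bound to the one required for
   [k.+1]. *)
have all_gtS s : all (leq k.+2) s = (k.+1 \notin s) && all (leq k.+1) s.
  elim: s => //= y s ->; rewrite inE negb_or ltn_neqAle -!andbA.
  by rewrite [k.+1 == y]eq_sym; do !bool_congr.
by rewrite all_gtS -andbA; congr (_ && _); rewrite andbCA.
Qed.

Lemma subseq_cons1 (T : eqType) (x y : T) s t :
  subseq (x :: s) (y :: t) -> subseq s t.
Proof.
rewrite /=; case: eqP => // _ sub_st.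
by apply: subseq_trans (subseq_cons s x) sub_st.
Qed.

Lemma avoids123 w : rgf_from 1 w -> avoids (1 :: w) [:: 1; 2; 3] = all (geq 2) w.
Proof.
move=> rgf_w; apply/idP/idP => [/containsP no123|le2].
  apply/negPn/negP => /allPn[c c_w]; rewrite -ltnNge => c_gt2; apply: no123.
  (* An RGF cannot skip 2, so a letter [c] above 2 has a 2 between the leading 1 and itself. *)
  exists [:: 1; 2; c]; last by apply/standardize123; exists 1, 2, c.
  rewrite /=; elim: w rgf_w c_w => // x w IHw /= /andP[/andP[x_gt0 x_le2] rgf_w].
  rewrite inE => /predU1P[eq_c|c_w]; first by rewrite eq_c ltnNge x_le2 in c_gt2.
  case: eqP => [_|ne_x2]; first by rewrite sub1seq.
  by apply: IHw => //; have x1 : x = 1 by [lia]; rewrite x1 in rgf_w.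
apply/containsP => -[s sub_s /standardize123].
case=> a [b [c [def_s /andP[lt_ab lt_bc]]]].
have mem_s x : x \in s -> x \in 1 :: w by apply: mem_subseq.
have a_gt0 : 0 < a.
  have : all (leq 1) (1 :: w) by rewrite /= (rgf_from_pos rgf_w).
  by move/allP; apply; apply: mem_s; rewrite def_s mem_head.
have : all (geq 2) (1 :: w) by rewrite /= le2.
move/allP/(_ c); rewrite mem_s ?def_s ?inE ?eqxx ?orbT //= => /(_ isT); lia.
Qed.

Lemma avoids122 w : rgf_from 1 w ->
  avoids (1 :: w) [:: 1; 2; 2] = uniq (filter (leq 2) w).
Proof.
move=> rgf_w; apply/idP/idP => [/containsP no122|uniq_w].
  apply/negPn/negP => not_uniq; apply: no122.
  have [b sub_b] : exists b, subseq [:: b; b] (filter (leq 2) w).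
    elim: (filter _ w) not_uniq => //= x t IHt.
    rewrite negb_and negbK => /orP[x_t|/IHt[b sub_b]].
      by exists x; rewrite eqxx sub1seq.
    by exists b; apply: subseq_trans sub_b (subseq_cons t x).
  have : b \in filter (leq 2) w by rewrite (mem_subseq sub_b) ?mem_head.
  rewrite mem_filter => /andP[b_gt1 _].
  (* The leading 1 serves as the small letter for any repeated letter above 1. *)
  exists [:: 1; b; b]; last by apply/standardize122; exists 1, b.
  by rewrite /= (subseq_trans sub_b) ?filter_subseq.
apply/containsP => -[s sub_s /standardize122].
case=> a [b [def_s lt_ab]]; rewrite {s}def_s in sub_s.
have a_gt0 : 0 < a.
  have : all (leq 1) (1 :: w) by rewrite /= (rgf_from_pos rgf_w).
  by move/allP; apply; apply: (mem_subseq sub_s); rewrite mem_head.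
have b_gt1 : 1 < b by apply: leq_ltn_trans lt_ab.
have sub_b : subseq [:: b; b] (filter (leq 2) w).
  by rewrite subseq_filter /= b_gt1 (subseq_cons1 sub_s).
by have := subseq_uniq sub_b uniq_w; rewrite /= inE eqxx.
Qed.

(** Shared by both patterns: [map (leq 2)] decodes, and the second hypothesis says that the avoiders
    are the words restored by [F] from their own bits. *)
Lemma perm_RGF_avoiding m v (F : bitseq -> seq nat) :
    cancel F (map (leq 2)) ->
    (forall w, rgf_from 1 w && avoids (1 :: w) v = (w == F (map (leq 2) w))) ->
  perm_eq (RGF_avoiding m.+1 v) [seq 1 :: F b | b <- bitseqs m].
Proof.
move=> FK charF; apply: uniq_perm.
- exact/filter_uniq/RGF_uniq.
- by rewrite map_inj_uniq ?bitseqs_uniq // => b c [/(can_inj FK)].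
move=> w; rewrite mem_filter mem_RGF is_rgf_from.
apply/and3P/mapP => [[av rgf_w sz_w]|[b]]; last first.
  rewrite mem_bitseqs => sz_b ->.
  have := charF (F b); rewrite FK eqxx => /andP[rgf_b ->].
  by split; rewrite //= eqSS -(size_map (leq 2)) FK.
case: w av rgf_w sz_w => // x w av /= /andP[x01 rgf_w] sz_w.
case: x x01 av rgf_w => [|[|]] // _ av rgf_w.
exists (map (leq 2) w); first by rewrite mem_bitseqs size_map.
by congr (_ :: _); apply/eqP; rewrite -charF -[1]/(maxn 0 1) rgf_w.
Qed.

Lemma perm_RGF_avoiding123 m :
  perm_eq (RGF_avoiding m.+1 [:: 1; 2; 3])
    [seq 1 :: two_letters b | b <- bitseqs m].
Proof.
apply: perm_RGF_avoiding two_lettersK _ => w.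
rewrite -(rgf_from_two_letters w (ltn0Sn 0)).
by apply: andb_id2l => /avoids123.
Qed.

Lemma perm_RGF_avoiding122 m :
  perm_eq (RGF_avoiding m.+1 [:: 1; 2; 2])
    [seq 1 :: ascending_letters 2 b | b <- bitseqs m].
Proof.
apply: perm_RGF_avoiding => [|w]; first exact: ascending_lettersK.
rewrite -(rgf_from_ascending w (ltn0Sn 0)) filter_all andbT.
by apply: andb_id2l => /avoids122.
Qed.

(** * The statistics on encoded words *)

Lemma rs_cons x w : rs (x :: w) = size (undup [seq y <- w | y < x]) + rs w.
Proof. by rewrite /rs big_ord_recl /rs_at /= drop0. Qed.

Lemma lb_rcons w x : lb (rcons w x) = lb w + size (undup [seq y <- w | x < y]).
Proof.
rewrite /lb size_rcons big_ord_recr /=; congr (_ + _).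
  apply: eq_bigr => i _; rewrite /lb_at nth_rcons ltn_ord -cats1 takel_cat //.
  exact/ltnW.
by rewrite /lb_at nth_rcons ltnn eqxx -cats1 take_size_cat.
Qed.

(** In the encoded words the letters counted at a position are all equal, so each position
    contributes 0 or 1. *)
Lemma size_undup_nseq (T : eqType) n (x : T) : size (undup (nseq n x)) = (0 < n).
Proof.
by elim: n => //= n IHn; rewrite mem_nseq eqxx andbT; case: n IHn.
Qed.

Lemma rs_two_letters b : rs (1 :: two_letters b) = true_before_false b.
Proof.
have lt1 s : [seq y <- two_letters s | y < 1] = [::] by elim: s.
have lt2 s : [seq y <- two_letters s | y < 2] = nseq (count negb s) 1.
  by elim: s => //= -[] s ->.
rewrite rs_cons lt1 add0n; elim: b => [|c b IHb]; first by rewrite /rs big_ord0.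
rewrite /= rs_cons IHb; case: c => /=; last by rewrite lt1.
by rewrite lt2 size_undup_nseq has_count.
Qed.

Lemma rs_ascending_letters b :
  rs (1 :: ascending_letters 2 b) = true_before_false b.
Proof.
have lt1 s k : 0 < k -> [seq y <- ascending_letters k s | y < 1] = [::].
  by elim: s k => [|[] s IHs] k k_gt0 //=; rewrite IHs // ltnNge k_gt0.
(* Later letters above 1 are at least [k], so only the 1s lie below [i]. *)
have ltk s k i : 1 < i -> i <= k ->
    [seq y <- ascending_letters k s | y < i] = nseq (count negb s) 1.
  move=> i_gt1; elim: s k => [|[] s IHs] k le_ik //=.
    by rewrite ltnNge le_ik IHs // ltnW.
  by rewrite i_gt1 IHs.
rewrite rs_cons lt1 // add0n.
suff E k : 1 < k -> rs (ascending_letters k b) = true_before_false b by exact: E.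
elim: b k => [|c b IHb] k k_gt1.
  by rewrite /rs big_ord0.
case: c => /=; rewrite rs_cons IHb //; try exact: ltnW.
  by rewrite ltk // size_undup_nseq has_count.
by rewrite lt1 // ltnW.
Qed.

Lemma lb_two_letters b :
  lb (1 :: two_letters b) = true_before_false (rev (map negb b)).
Proof.
have gt2 s : [seq y <- two_letters s | 2 < y] = [::] by elim: s => //= -[] s ->.
have gt1 s : [seq y <- two_letters s | 1 < y] = nseq (count id s) 2.
  by elim: s => //= -[] s ->.
(* Since [lb] looks left, the induction removes the last letter, whose negated bit heads the
   reversed sequence. *)
elim/last_ind: b => [|b c IHb]; first by rewrite (lb_rcons [::]) /lb big_ord0.
rewrite /two_letters map_rcons -rcons_cons lb_rcons -/(two_letters b) IHb.
rewrite map_rcons rev_rcons /= has_rev has_map addnC; congr (_ + _).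
case: c => /=; first by rewrite gt2.
rewrite gt1 size_undup_nseq -has_count; congr nat_of_bool.
by apply: eq_has => -[].
Qed.

Theorem theorem2p10 (n : nat) :
  [/\ RS n [:: 1; 2; 2] = LB n [:: 1; 2; 3],
      LB n [:: 1; 2; 3] = RS n [:: 1; 2; 3]
    & RS n [:: 1; 2; 3] =
        (1 + \sum_(0 <= k < n.-1) 'C(n.-1, k.+1)%:R *: 'X^k)%R].
Proof.
suff [E122 ELB E123] : [/\
    RS n [:: 1; 2; 2] = (1 + \sum_(0 <= k < n.-1) 'C(n.-1, k.+1)%:R *: 'X^k)%R,
    LB n [:: 1; 2; 3] = (1 + \sum_(0 <= k < n.-1) 'C(n.-1, k.+1)%:R *: 'X^k)%R
  & RS n [:: 1; 2; 3] = (1 + \sum_(0 <= k < n.-1) 'C(n.-1, k.+1)%:R *: 'X^k)%R].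
  by rewrite E122 ELB E123.
case: n => [|m].
  (* For [n = 0] the empty word alone gives 1; as [0.-1] is 0, the binomial sum is empty. *)
  have RGF0 v : v != [::] -> perm_eq (RGF_avoiding 0 v) [:: [::]].
    move=> v_neq0; apply: uniq_perm => //; first exact/filter_uniq/RGF_uniq.
    move=> w; rewrite mem_filter mem_RGF inE; case: w => [|x w]; last by rewrite !andbF.
    rewrite is_rgf_from andbT; apply/containsP => -[s].
    by rewrite subseq0 => /eqP-> def_v; rewrite -def_v in v_neq0.
  by split; rewrite /RS /LB (perm_big _ (RGF0 _ _)) // big_seq1 big_geq //
    /rs /lb big_ord0 addr0.
rewrite -pred_Sn -sum_bitseqsE; split.
- rewrite /RS (perm_big _ (perm_RGF_avoiding122 m)) big_map.
  by apply: eq_bigr => b _; rewrite rs_ascending_letters.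
- rewrite /LB (perm_big _ (perm_RGF_avoiding123 m)) big_map.
  rewrite -(sum_bitseqs_rev_negb m (fun b => 'X^(true_before_false b))%R).
  by apply: eq_bigr => b _; rewrite lb_two_letters.
rewrite /RS (perm_big _ (perm_RGF_avoiding123 m)) big_map.
by apply: eq_bigr => b _; rewrite rs_two_letters.
Qed.
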